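(* Let $S$ be a bzi-semiring. For any $z$-ideal $\mathfrak{a}$ of $S$, the following are equivalent. (1) $\mathfrak{a}$ is $z$-semiprime. (2) $\mathfrak{a}$ is an intersection of $z$-prime ideals of $S$. (3) $\mathfrak{a}$ is a $z$-radical ideal, i.e. $\sqrt[z]{\mathfrak{a}}=\mathfrak{a}$.
   Context: A (commutative) semiring is a system $(S,+,0,\cdot,1)$ with $(S,+,0)$ and $(S,\cdot,1)$ commutative monoids, $0s=0$ for all $s\in S$, and multiplication distributing over addition. An ideal of $S$ is a nonempty subset closed under addition and under multiplication by elements of $S$; it is proper if it is not $S$. The product $\mathfrak{a}\mathfrak{b}$ of ideals is the ideal generated by $\{ab\mid a\in\mathfrak{a},b\in\mathfrak{b}\}$, and $\mathfrak{a}^2=\mathfrak{a}\mathfrak{a}$. $\mathrm{Max}(S)$ is the set of maximal (proper) ideals of $S$, and for $x\in S$, $\mathcal{M}_x=\{\mathfrak{m}\in\mathrm{Max}(S)\mid x\in\mathfrak{m}\}$. An ideal $\mathfrak{z}$ of $S$ is a $z$-ideal if $\bigcap\mathcal{M}_x\subseteq\mathfrak{z}$ for every $x\in\mathfrak{z}$. A basic $z$-ideal is an ideal of the form $\mathsf{m}_x=\bigcap\mathcal{M}_x$, $x\in S$; $S$ is a bzi-semiring if every basic $z$-ideal is idempotent, i.e. $\mathsf{m}_x\mathsf{m}_x=\mathsf{m}_x$ for all $x\in S$. A proper $z$-ideal $\mathfrak{p}$ is $z$-prime if for all $z$-ideals $\mathfrak{a},\mathfrak{b}$ of $S$, $\mathfrak{a}\mathfrak{b}\subseteq\mathfrak{p}$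 implies $\mathfrak{a}\subseteq\mathfrak{p}$ or $\mathfrak{b}\subseteq\mathfrak{p}$. A proper $z$-ideal $\mathfrak{p}$ is $z$-semiprime if for all $z$-ideals $\mathfrak{a}$ of $S$, $\mathfrak{a}^2\subseteq\mathfrak{p}$ implies $\mathfrak{a}\subseteq\mathfrak{p}$. The $z$-radical $\sqrt[z]{\mathfrak{a}}$ of a $z$-ideal $\mathfrak{a}$ is the intersection of all $z$-prime ideals of $S$ containing $\mathfrak{a}$.
   Formalization: The z-ideal is assumed proper: for the z-ideal equal to S itself, (2) and (3) hold (empty intersection being S) while (1) fails because z-semiprime ideals are proper by definition. *)

(* Defs.v *)
From mathcomp Require Import all_boot all_algebra.
From mathcomp Require Import classical_sets.

Set Implicit Arguments.
Unset Strict Implicit.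
Unset Printing Implicit Defensive.

Local Open Scope ring_scope.
Local Open Scope classical_set_scope.

(* Semirings are [comPzSemiRingType]: the trivial semiring (0 = 1) is allowed. *)

Definition is_ideal (S : comPzSemiRingType) (I : set S) : Prop :=
  [/\ I !=set0,
      forall x y : S, I x -> I y -> I (x + y) &
      forall s x : S, I x -> I (s * x)].

Definition is_proper (S : comPzSemiRingType) (I : set S) : Prop := I <> setT.

Definition ideal_gen (S : comPzSemiRingType) (X : set S) : set S :=
  smallest (@is_ideal S) X.

Definition ideal_mul (S : comPzSemiRingType) (A B : set S) : set S :=
  ideal_gen [set a * b | a in A & b in B].

Definition maximal_ideal (S : comPzSemiRingType) (M : set S) : Prop :=
  [/\ is_ideal M, is_proper M &
      forall J : set S, is_ideal J -> is_proper J -> M `<=` J -> J = M].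

Definition Max_at (S : comPzSemiRingType) (x : S) : set (set S) :=
  [set M | maximal_ideal M /\ M x].

(* When no maximal ideal contains [x], the intersection is the whole of [S]. *)
Definition basic_z (S : comPzSemiRingType) (x : S) : set S :=
  \bigcap_(M in Max_at x) M.

Definition z_ideal (S : comPzSemiRingType) (Z : set S) : Prop :=
  is_ideal Z /\ forall x : S, Z x -> basic_z x `<=` Z.

Definition bzi_semiring (S : comPzSemiRingType) : Prop :=
  forall x : S, ideal_mul (basic_z x) (basic_z x) = basic_z x.

Definition z_prime (S : comPzSemiRingType) (P : set S) : Prop :=
  [/\ z_ideal P, is_proper P &
      forall A B : set S, z_ideal A -> z_ideal B ->
        ideal_mul A B `<=` P -> A `<=` P \/ B `<=` P].

Definition z_semiprime (S : comPzSemiRingType) (P : set S) : Prop :=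
  [/\ z_ideal P, is_proper P &
      forall A : set S, z_ideal A -> ideal_mul A A `<=` P -> A `<=` P].

Definition z_radical (S : comPzSemiRingType) (A : set S) : set S :=
  \bigcap_(P in [set P | z_prime P /\ A `<=` P]) P.

(* The family [F] may be empty: [S] itself is then an intersection of z-primes,
   and likewise [z_radical setT = setT], although [S] is not z-semiprime. The
   equivalence with [z_semiprime] is therefore about proper z-ideals only. *)
Definition inter_of_z_primes (S : comPzSemiRingType) (A : set S) : Prop :=
  exists F : set (set S), F `<=` @z_prime S /\ A = \bigcap_(P in F) P.

(* Main.v *)
(** In a commutative semiring maximal ideals are prime, so for a z-ideal P and
    an element b the colon ideal (P : b) is again a z-ideal, and x ^+ 2 \in P
    implies x \in P. Given a z-ideal a and x \notin a, Zorn's lemma yields a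
    z-ideal P containing a and maximal with x \notin P. If u b \in P with u, b
    outside P, then (P : b) contains u, hence x by maximality; so (P : x)
    contains b, hence x, and x ^+ 2 \in P is a contradiction. Thus P is z-prime,
    and every z-ideal is the intersection of the z-primes above it. *)

Require Import Defs.
From mathcomp Require Import all_boot all_algebra.
From mathcomp Require Import boolp classical_sets.

Set Implicit Arguments.
Unset Strict Implicit.
Unset Printing Implicit Defensive.

Import GRing.Theory.
Local Open Scope ring_scope.
Local Open Scope classical_set_scope.

Section ZIdeals.
Variable S : comPzSemiRingType.
Implicit Types (M P A : set S) (x y b : S).

(** If [x] lies outside [M], then [J = M + S x] is all of [S]; writing [1 = m + s * x] gives
    [y = m * y + s * (x * y)], a sum of two elements of [M]. *)
Lemma maximal_ideal_prime M x y :
  maximal_ideal M -> M (x * y) -> M x \/ M y.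
Proof.
move=> [[[m0 Mm0] MD MM] _ Mmax] Mxy.
have [Mx|nMx] := pselect (M x); [by left | right].
have M0 : M 0 by rewrite -(mul0r m0); exact: MM.
pose J := [set z | exists m s, M m /\ z = m + s * x].
have JI : is_ideal J.
  split.
  - by exists 0, 0, 0; rewrite mul0r addr0.
  - move=> _ _ [m [s [Mm ->]]] [m' [s' [Mm' ->]]].
    by exists (m + m'), (s + s'); rewrite mulrDl addrACA; split; [exact: MD|].
  - move=> t _ [m [s [Mm ->]]].
    by exists (t * m), (t * s); rewrite mulrDr mulrA; split; [exact: MM|].
have MJ : M `<=` J by move=> m Mm; exists m, 0; rewrite mul0r addr0.
have JT : J = setT.
  apply: contrapT => /(Mmax J JI)/(_ MJ) JM.
  by apply: nMx; rewrite -JM; exists 0, 1; rewrite mul1r add0r.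
have [m [s [Mm e1]]] : J 1 by rewrite JT.
rewrite -(mul1r y) e1 mulrDl; apply: MD; first by rewrite mulrC; exact: MM.
by rewrite -mulrA; exact: MM.
Qed.

(** A maximal ideal containing [s * b] contains [s] or [b]. For [u] in [basic_z s] it contains
    [u * b] in either case, so [u * b] lies in [basic_z (s * b)], hence in [P]. *)
Lemma z_ideal_colon P b : z_ideal P -> z_ideal [set s | P (s * b)].
Proof.
move=> [[[p Pp] PD PM] Pz]; split; first split.
- by exists p; rewrite /= mulrC; exact: PM.
- by move=> x y /= Px Py; rewrite mulrDl; exact: PD.
- by move=> s x /= Px; rewrite -mulrA; exact: PM.
move=> s /= Psb u us; apply: (Pz _ Psb) => M [Mmax Msb].
have [_ _ MM] : is_ideal M by case: Mmax.
have [Ms|Mb] := maximal_ideal_prime Mmax Msb; last exact: MM.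
by rewrite mulrC; apply: MM; exact: us.
Qed.

Lemma z_ideal_sqr P x : z_ideal P -> P (x * x) -> P x.
Proof.
move=> [_ Pz] Pxx; apply: (Pz _ Pxx) => M [Mmax Mxx].
by case: (maximal_ideal_prime Mmax Mxx).
Qed.

Lemma z_ideal_maximal_avoiding A x : z_ideal A -> ~ A x ->
  exists P, [/\ z_ideal P, A `<=` P, ~ P x &
    forall Q, z_ideal Q -> P `<=` Q -> ~ Q x -> Q `<=` P].
Proof.
move=> zA nAx.
(* The [A `|`] makes the union of the empty chain a member of the family. *)
pose good X := z_ideal (A `|` X) /\ ~ (A `|` X) x.
have [|X [[zX nXx] Xmax]] := @Zorn_bigcup S good.
  move=> F Fgood Ftot.
  have AU X : F X -> A `|` X `<=` A `|` \bigcup_(Y in F) Y.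
    by move=> FX; apply: setUS => z Xz; exists X.
  have AA : A `<=` A `|` \bigcup_(Y in F) Y by move=> z; left.
  have [[[a0 Aa0] AD AM] Az] := zA.
  split; last by case=> [//|[X FX Xx]]; have [_] := Fgood _ FX; apply; right.
  split; first split.
  - by exists a0; left.
  (* Two summands coming from different members of the chain are added inside the larger one. *)
  - have addX X u v : F X -> (A `|` X) u -> (A `|` X) v ->
        (A `|` \bigcup_(Y in F) Y) (u + v).
      move=> FX Xu Xv; apply: (AU _ FX).
      by have [[[_ XD _] _] _] := Fgood _ FX; exact: XD.
    move=> u v [Au|[X FX Xu]] [Av|[Y FY Yv]].
    + by left; exact: AD.
    + by apply: (addX Y) => //; [left|right].
    + by apply: (addX X) => //; [right|left].
    + have [XY|YX] := Ftot _ _ FX FY.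
        by apply: (addX Y) => //; right => //; exact: XY.
      by apply: (addX X) => //; right => //; exact: YX.
  - move=> s u [Au|[X FX Xu]]; first by left; exact: AM.
    apply: (AU _ FX); have [[[_ _ XM] _] _] := Fgood _ FX.
    by apply: XM; right.
  - move=> u [Au|[X FX Xu]]; first by apply: subset_trans AA; exact: Az.
    apply: subset_trans (AU _ FX); have [[_ Xz] _] := Fgood _ FX.
    by apply: Xz; right.
exists (A `|` X); split=> // Q zQ XQ nQx; apply: contrapT => nQX.
have AQ : A `|` Q = Q by apply/setUidPr => z Az; apply: XQ; left.
apply: (Xmax Q); last by rewrite /good AQ.
by split=> [z Xz|QX]; [apply: XQ; right | apply: nQX => z /QX; right].
Qed.

Lemma z_prime_avoiding A x : z_ideal A -> ~ A x ->
  exists P, [/\ z_prime P, A `<=` P & ~ P x].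
Proof.
move=> zA /(z_ideal_maximal_avoiding zA)[P [zP AP nPx Pmax]].
have [[_ _ PM] _] := zP.
(* The colon ideal of [P] by [b] contains [P] and also [u], so maximality of [P] forces [x] into
   it. *)
have colonx b u : P (u * b) -> ~ P u -> P (x * b).
  move=> Pub nPu; apply: contrapT => nPxb; apply: nPu.
  apply: (Pmax _ (z_ideal_colon b zP)) => // p Pp.
  by rewrite /= mulrC; exact: PM.
exists P; split=> //; split=> // [PT|B C _ _ BCP]; first by apply: nPx; rewrite PT.
apply: contrapT => /not_orP[/nonsubset[u [Bu nPu]] /nonsubset[c [Cc nPc]]].
apply: nPx; apply: z_ideal_sqr zP _.
(* The factors are traded for [x] one at a time: from [u * c] to [x * c], then to [x * x]. *)
apply: (colonx x c) => //; rewrite mulrC; apply: (colonx c u) => //.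
by apply: BCP => J [_]; apply; exists u => //; exists c.
Qed.

Lemma z_radical_id A : z_ideal A -> z_radical A = A.
Proof.
move=> zA; apply/seteqP; split=> [x Ax|x Ax P [_]]; last exact.
apply: contrapT => /(z_prime_avoiding zA)[P [pP AP]]; apply.
exact: Ax.
Qed.

End ZIdeals.

Theorem theorem4p16 (S : comPzSemiRingType) (hS : bzi_semiring S)
    (a : set S) (ha : z_ideal a) (ha_proper : is_proper a) :
  [<-> z_semiprime a;
       inter_of_z_primes a;
       z_radical a = a].
Proof.
tfae.
(* The intersection of this family is [z_radical a] by definition. *)
- move=> _; exists [set P | z_prime P /\ a `<=` P].
  by split=> [P []|]; last exact/esym/z_radical_id.
- by move=> _; exact: z_radical_id.
(* Each z-prime [P] above [a] contains the square of [A], hence [A] itself. *)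
- move=> rad_a; split=> // A zA AAa; rewrite -rad_a => x Ax P [pP aP].
  have [_ _ /(_ A A zA zA)] := pP.
  by case=> [|AP|AP]; [exact: subset_trans aP | exact: AP | exact: AP].
Qed.
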